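(* Let $A$ be an uncountable abelian Polish group. Then at least one of the following holds: (1) $\ell^1(\mathbb Z)\sqsubseteq^{\mathbb Z}A$; (2) $(\mathbb Z/p\mathbb Z)^{\mathbb N}\sqsubseteq^{\mathbb Z}A$ for some prime $p$.
   Context: $\mathbb Z$ carries the usual absolute value (a proper norm) and the discrete topology; abelian Polish groups are Polish $\mathbb Z$-modules. $M\sqsubseteq^{\mathbb Z}N$ means there is a continuous group homomorphism $M\to N$ which is injective. $\ell^1(\mathbb Z)=\{(n_k)_{k\in\mathbb N}\in\mathbb Z^{\mathbb N}:\sum_k|n_k|/k!<\infty\}$ with the norm $\sum_k|n_k|/k!$ (and associated metric topology). $(\mathbb Z/p\mathbb Z)^{\mathbb N}$ has the product topology. *)

(* Defs.v *)
From HB Require Import structures.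
From mathcomp Require Import all_boot all_order all_algebra.
From mathcomp Require Import all_classical all_reals all_analysis.
From mathcomp Require Import Rstruct Rstruct_topology.
Set Implicit Arguments. Unset Strict Implicit. Unset Printing Implicit Defensive.
Import Order.TTheory GRing.Theory Num.Theory.
Local Open Scope classical_set_scope.
Local Open Scope ring_scope.

Notation RR := Rdefinitions.R.

Definition is_metric (T : Type) (d : T -> T -> RR) : Prop :=
  [/\ forall x y, d x y = 0 <-> x = y,
      forall x y, d x y = d y x &
      forall x y z, d x z <= d x y + d y z].

Definition metric_induces (T : topologicalType) (d : T -> T -> RR) : Prop :=
  forall (x : T) (U : set T),
    nbhs x U <-> exists2 e : RR, 0 < e & [set y | d x y < e] `<=` U.

Definition metric_complete (T : topologicalType) (d : T -> T -> RR) : Prop :=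
  forall u : nat -> T,
    (forall e : RR, 0 < e -> exists N, forall m n, (N <= m)%N -> (N <= n)%N ->
        d (u m) (u n) < e) ->
    exists l : T, u @ \oo --> l.

Definition polish_space (T : topologicalType) : Prop :=
  (exists D : set T, countable D /\ dense D) /\
  (exists d : T -> T -> RR, [/\ is_metric d, metric_induces d & metric_complete d]).

Definition l1_terms (x : nat -> int) : nat -> RR :=
  fun k => (`|x k|%:~R : RR) / (k`!)%:R.

Definition in_l1Z (x : nat -> int) : Prop := cvgn (series (l1_terms x)).

Definition l1Z_norm (x : nat -> int) : RR := limn (series (l1_terms x)).

Definition l1Z_embeds (A : topologicalZmodType) : Prop :=
  exists f : (nat -> int) -> A,
    [/\ (forall x y, in_l1Z x -> in_l1Z y -> f (fun k => x k + y k) = f x + f y),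
        (forall x y, in_l1Z x -> in_l1Z y -> f x = f y -> x = y) &
        (forall x, in_l1Z x -> forall U, nbhs (f x) U ->
           exists2 e : RR, 0 < e & forall y, in_l1Z y ->
             l1Z_norm (fun k => x k - y k) < e -> U (f y))].

(* (Z/pZ)^N ⊑^Z A, with the product topology of discrete factors:
   basic neighbourhoods of x are { y | y k = x k for all k < N } *)
Definition ZpN_embeds (p : nat) (A : topologicalZmodType) : Prop :=
  exists g : (nat -> 'Z_p) -> A,
    [/\ (forall x y, g (fun k => x k + y k) = g x + g y),
        injective g &
        (forall x U, nbhs (g x) U ->
           exists N : nat, forall y, (forall k, (k < N)%N -> y k = x k) -> U (g y))].

(* Main.v *)
(* Build a sequence [a_k] converging to [0] so fast that [x |-> \sum_k x_k a_k]
   converges whenever [|x_k| <= k!] eventually, which holds for every [x] in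
   l^1(Z) and for every lift to [{0, ..., p-1}] of a sequence in Z/p.  At step [k]
   there are only finitely many partial sums with coefficients bounded by [k!], so
   [a_k] can be chosen to move each of them by less than a small fraction of the
   distance to [0] of every nonzero one; hence a sum vanishes only if its partial
   sums eventually vanish.  It remains to choose [a_k] independent of the previous
   terms.  If the [p]-torsion accumulates at [0] for some prime [p], take [a_k] to
   be [p]-torsion and outside the finite group generated so far.  Otherwise every
   [A[n]], n > 0, is discrete, so the elements having a nonzero multiple in a given
   finitely generated subgroup form a countable set, while neighbourhoods of [0]
   are uncountable. *)
Require Import Defs.
From mathcomp Require Import all_boot all_order all_algebra.
From mathcomp Require Import all_classical all_reals all_analysis.
From mathcomp Require Import Rstruct Rstruct_topology.
From mathcomp Require Import zify lra.
Set Implicit Arguments. Unset Strict Implicit. Unset Printing Implicit Defensive.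
Import Order.TTheory GRing.Theory Num.Theory numFieldNormedType.Exports.
Local Open Scope classical_set_scope.
Local Open Scope ring_scope.

(** * Integer combinations of a finite list with bounded coefficients *)

Definition int_range (M : nat) : seq int :=
  [seq i%:Z - M%:Z | i <- iota 0 M.*2.+1].

Lemma mem_int_range (M : nat) (n : int) : (n \in int_range M) = (`|n| <= M)%N.
Proof.
apply/mapP/idP => [[i]|nM].
  by rewrite mem_iota => /andP[_ iM] ->; lia.
exists (absz (n + M%:Z)); last by lia.
by rewrite mem_iota; lia.
Qed.

(** An explicit list rather than a predicate, so that neighbourhood conditions can be intersected
    over its entries and the entries can be numbered. *)
Fixpoint sums (A : zmodType) (M : nat) (l : seq A) : seq A :=
  if l is a :: l' then [seq s + a *~ n | s <- sums M l', n <- int_range M]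
  else [:: 0].

Lemma sums_consP (A : zmodType) (M : nat) (a : A) (l : seq A) (s : A) :
  s \in sums M (a :: l) <->
  exists t n, [/\ t \in sums M l, (`|n| <= M)%N & s = t + a *~ n].
Proof.
split => [/allpairsP[[t n] /= [tl]]|[t [n [tl nM ->]]]].
  by rewrite mem_int_range; exists t, n.
by apply/allpairsP; exists (t, n); rewrite /= mem_int_range.
Qed.

Lemma sums0 (A : zmodType) (M : nat) (l : seq A) : 0 \in sums M l.
Proof.
elim: l => [|a l IH]; first by rewrite mem_head.
by apply/sums_consP; exists 0, 0; rewrite mulr0z addr0.
Qed.

Lemma sumsMz (A : zmodType) (M : nat) (l : seq A) (s : A) (n : int) :
  s \in sums M l -> s *~ n \in sums (M * `|n|)%N l.
Proof.
elim: l s => [|a l IH] s; first by rewrite !inE => /eqP ->; rewrite mul0rz.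
move=> /sums_consP[t [m [tl mM ->]]].
apply/sums_consP; exists (t *~ n), (m * n); split; first exact: IH.
  by rewrite abszM leq_mul2r mM orbT.
by rewrite mulrzDl mulrzA.
Qed.

(** Reducing every coefficient modulo [p] does not change the combination, so one finite list
    exhausts the group generated by [l]. *)
Lemma sums_torsion (A : zmodType) (p M : nat) (l : seq A) (s : A) :
  (0 < p)%N -> (forall a, a \in l -> a *+ p = 0) ->
  s \in sums M l -> s \in sums p l.
Proof.
move=> p0; elim: l s => [//|a l IH] s pl /sums_consP[t [m [tl _ ->]]].
apply/sums_consP; exists t, (m %% p%:Z)%Z; split.
- by apply: IH => // b bl; rewrite pl// inE bl orbT.
- have := modz_ge0 m (d := p%:Z); have := @ltz_pmod m p%:Z; lia.
- have {1}-> : m = p%:Z * (m %/ p%:Z)%Z + (m %% p%:Z)%Z.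
    by rewrite mulrC -divz_eq.
  by rewrite mulrzDr mulrzA -pmulrn pl ?mem_head// mul0rz add0r.
Qed.

(** * Partial sums and independence *)

Definition psum (A : zmodType) (a : nat -> A) (x : nat -> int) (k : nat) : A :=
  \sum_(j < k) a j *~ x j.

Lemma psumS (A : zmodType) (a : nat -> A) (x : nat -> int) (k : nat) :
  psum a x k.+1 = psum a x k + a k *~ x k.
Proof. by rewrite /psum big_ord_recr. Qed.

Lemma psum0 (A : zmodType) (a : nat -> A) (x : nat -> int) (k : nat) :
  (forall j, (j < k)%N -> x j = 0) -> psum a x k = 0.
Proof. by move=> x0; apply: big1 => i _; rewrite x0// mulr0z. Qed.

Definition prefix_rev (A : zmodType) (a : nat -> A) (k : nat) : seq A :=
  rev (mkseq a k).

Lemma prefix_revS (A : zmodType) (a : nat -> A) (k : nat) :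
  prefix_rev a k.+1 = a k :: prefix_rev a k.
Proof. by rewrite /prefix_rev /mkseq -addn1 iotaD map_cat rev_cat. Qed.

(** The terms from [k] up to [i] enter with coefficient [0]; this slack lets an early partial sum be
    compared with all later steps. *)
Lemma psum_in_sums (A : zmodType) (a : nat -> A) (x : nat -> int) (M i k : nat) :
  (k <= i)%N -> (forall j, (j < k)%N -> (`|x j| <= M)%N) ->
  psum a x k \in sums M (prefix_rev a i).
Proof.
elim: i k => [|i IH] k.
  by rewrite leqn0 => /eqP -> _; rewrite /psum big_ord0 mem_head.
rewrite leq_eqVlt prefix_revS => /predU1P[->|ki] xM; apply/sums_consP.
  exists (psum a x i), (x i); rewrite psumS; split => //; last exact: xM.
  by apply: IH => // j ji; apply: xM; lia.
by exists (psum a x k), 0; rewrite mulr0z addr0; split => //; exact: IH.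
Qed.

(** Asking for [a *~ n = 0] rather than [n = 0] leaves room for torsion elements. *)
Definition independent_from (A : zmodType) (l : seq A) (a : A) : Prop :=
  forall (n : int) (M : nat), a *~ n \in sums M l -> a *~ n = 0.

(** In a vanishing sum the last term is minus a combination of the earlier ones, hence zero by
    independence; dropping it, one descends. *)
Lemma psum_eq0 (A : zmodType) (a : nat -> A) (x : nat -> int) (k : nat) :
  (forall i, independent_from (prefix_rev a i) (a i)) ->
  psum a x k = 0 -> forall j, (j < k)%N -> a j *~ x j = 0.
Proof.
move=> ind; elim: k => [//|k IH]; rewrite psumS => s0.
have ak0 : a k *~ x k = 0.
  have E : a k *~ x k = psum a x k *~ (-1).
    by rewrite mulrN1z; apply/eqP; rewrite -addr_eq0 addrC s0.
  pose M := (\max_(i < k) `|x i|)%N.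
  apply: (ind k _ (M * `|(-1 : int)|)%N); rewrite E.
  apply/sumsMz/psum_in_sums => // j jk.
  exact: (leq_bigmax (Ordinal jk)).
move: s0; rewrite ak0 addr0 => /IH{}IH j; rewrite ltnS leq_eqVlt.
by move=> /predU1P[-> //|]; exact: IH.
Qed.

Lemma torsion_mulrz_inv (A : zmodType) (p : nat) (a : A) (n : int) :
  prime p -> a *+ p = 0 -> ~~ (p%:Z %| n)%Z -> exists u, a *~ n *~ u = a.
Proof.
move=> pp ap pn; have cop : coprimez n p%:Z.
  by rewrite coprimezE coprime_sym prime_coprime.
case/coprimezP: cop => -[u v] /= uv; exists u.
by rewrite -mulrzA -[RHS]mulr1z -uv mulrzDr (mulrC v) (mulrzA a p%:Z) -pmulrn ap
  mul0rz addr0 mulrC.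
Qed.

Lemma torsion_mulrz_dvd (A : zmodType) (p : nat) (a : A) (n : int) :
  a *+ p = 0 -> (p%:Z %| n)%Z -> a *~ n = 0.
Proof. by move=> ap /dvdzP[m ->]; rewrite mulrC mulrzA -pmulrn ap mul0rz. Qed.

(** * Neighbourhoods, countability and torsion in topological groups *)

Lemma cvg_add (A : topologicalZmodType) (T : Type) (F : set_system T)
    (FF : Filter F) (f g : T -> A) (a b : A) :
  f @ F --> a -> g @ F --> b -> f x + g x @[x --> F] --> a + b.
Proof. by move=> fa gb; apply: cvg_comp2 fa gb _; exact: (add_continuous (a, b)). Qed.

Lemma cvg_opp (A : topologicalZmodType) (T : Type) (F : set_system T)
    (FF : Filter F) (f : T -> A) (a : A) :
  f @ F --> a -> - f x @[x --> F] --> - a.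
Proof. by move=> fa; apply: cvg_comp fa _; exact: (opp_continuous a). Qed.

Lemma mulrz_continuous (A : topologicalZmodType) (n : int) :
  continuous (fun a : A => a *~ n).
Proof.
have natc m : continuous (fun a : A => a *+ m).
  elim: m => [|m IH] a; first exact: cvg_cst.
  rewrite /continuous_at mulrSr; under eq_fun do rewrite mulrSr.
  by apply: cvg_add => //; exact: IH.
by case: n => m a; [exact: natc|apply: cvg_opp; exact: natc].
Qed.

Lemma near_shift (A : topologicalZmodType) (s : A) (n : int) (U : set A) :
  nbhs s U -> \forall a \near (0 : A), U (s + a *~ n).
Proof.
suff : s + a *~ n @[a --> (0 : A)] --> s by exact.
rewrite -[X in _ --> X]addr0 -[X in _ --> _ + X](mul0rz A n).
by apply: cvg_add; [exact: cvg_cst|exact: mulrz_continuous].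
Qed.

Lemma near_sub (A : topologicalZmodType) (s : A) (U : set A) :
  nbhs s U -> \forall a \near (0 : A), U (s - a).
Proof. by move=> /(@near_shift _ _ (-1)); apply: filterS => a; rewrite mulrN1z. Qed.

Lemma nbhs_shift (A : topologicalZmodType) (s : A) (U : set A) :
  nbhs 0 U -> \forall x \near s, U (s - x).
Proof.
suff : s - x @[x --> s] --> (0 : A) by exact.
by rewrite -(subrr s); apply: cvg_add; [exact: cvg_cst|exact: (cvg_opp _ cvg_id)].
Qed.

Lemma near_seq (T : eqType) (S : Type) (F : set_system S) (FF : Filter F)
    (P : T -> S -> Prop) (r : seq T) :
  (forall t, t \in r -> \forall x \near F, P t x) ->
  \forall x \near F, forall t, t \in r -> P t x.
Proof.
elim: r => [|t r IH] rP; first exact: nearW.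
near=> x => u; rewrite inE => /predU1P[->|]; first by near: x; exact/rP/mem_head.
move: u; near: x; by apply: IH => u ur; apply: rP; rewrite inE ur orbT.
Unshelve. all: by end_near. Qed.

Lemma dense_nbhs (A : topologicalType) (D U : set A) (x : A) :
  dense D -> nbhs x U -> exists2 y, U y & D y.
Proof.
move=> dD; rewrite nbhsE => -[W [oW Wx] WU].
by have [y [/WU Uy Dy]] := dD W (ex_intro _ _ Wx) oW; exists y.
Qed.

(** Approximate each [s] by a point [q s] of [D] so closely that two elements with the same
    approximation differ by a member of [V]; then [q] is injective on [S]. *)
Lemma separated_countable (A : topologicalZmodType) (D S V : set A) :
  countable D -> dense D -> nbhs 0 V ->
  (forall s t, S s -> S t -> V (s - t) -> s = t) -> countable S.
Proof.
move=> cD dD V0 SV.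
have [[P Q] /= [P0 Q0] PQ] : nbhs ((0 : A), (0 : A)) [set x | V (x.1 - x.2)].
  by have := @sub_continuous A (0, 0) V; rewrite /= subr0; exact.
have /choice[q qP] : forall s, exists y, [/\ P (s - y), Q (s - y) & D y].
  move=> s; have /(dense_nbhs dD)[y [Py Qy] Dy] : nbhs s [set y | P (s - y) /\ Q (s - y)].
    by apply: filterI; exact: nbhs_shift.
  by exists y.
have /countable_injP[f fi] := cD.
apply/countable_injP; exists (f \o q) => s t /set_mem Ss /set_mem St /= E.
have [Ps _ Ds] := qP s; have [_ Qt Dt] := qP t.
have {}E : q s = q t by apply: fi => //; exact/mem_set.
apply: SV => //; have := PQ (s - q s, t - q t); rewrite /= E.
by rewrite opprB addrA subrK; apply; split => //=; rewrite -E.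
Qed.

(** The translates of [U] by the points of [D] cover the group. *)
Lemma nbhs_countable (A : topologicalZmodType) (D U : set A) :
  countable D -> dense D -> nbhs 0 U -> countable U -> countable [set: A].
Proof.
move=> cD dD U0 cU.
apply: (sub_countable _ (countableX cU cD)).
apply: card_le_trans (card_image_le (fun u : A * A => u.1 + u.2) _).
apply: subset_card_le => a _.
have [y Uy Dy] := dense_nbhs dD (nbhs_shift a U0).
by exists (a - y, y); rewrite //= subrK.
Qed.

(** Write [n = m * p] with [p] prime: for small [a] killed by [n], the element [a *+ m] is small and
    killed by [p], hence zero, and induction applies to [m]. *)
Lemma torsion_discrete (A : topologicalZmodType) (n : nat) :
  (forall p, prime p -> \forall a \near (0 : A), a *+ p = 0 -> a = 0) ->
  (0 < n)%N -> \forall a \near (0 : A), a *+ n = 0 -> a = 0.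
Proof.
move=> tor; elim/ltn_ind: n => n IH n0.
have [n1|n1] := leqP n 1.
  have -> : n = 1%N by lia.
  by apply: nearW => a; rewrite mulr1n.
have pp := pdiv_prime n1; pose p := pdiv n; pose m := (n %/ p)%N.
have nE : n = (m * p)%N by rewrite /m divnK// pdiv_dvd.
have mn : (m < n)%N by rewrite ltn_Pdiv// prime_gt1.
have m0 : (0 < m)%N by lia.
have nearm : \forall a \near (0 : A), a *+ m *+ p = 0 -> a *+ m = 0.
  have := @mulrz_continuous A m 0 [set b | b *+ p = 0 -> b = 0].
  by rewrite mul0rz; apply; exact: tor.
near=> a => an; have am : a *+ m = 0.
  by apply: (near nearm a _) => //; rewrite -mulrnA -nE.
by move: am; near: a; exact: IH.
Unshelve. all: by end_near. Qed.

(** Otherwise [U] is covered by countably many fibres of multiplications by nonzero integers. Points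
    of one fibre differ by torsion of a fixed order, which is discrete, so each fibre is countable,
    and then so is the whole group. *)
Lemma exists_independent (A : topologicalZmodType) (D : set A) (l : seq A)
    (U : set A) :
  countable D -> dense D -> ~ countable [set: A] ->
  (forall p, prime p -> \forall a \near (0 : A), a *+ p = 0 -> a = 0) ->
  nbhs 0 U ->
  exists2 a, U a & forall (n : int) M, a *~ n \in sums M l -> n = 0.
Proof.
move=> cD dD unc tor U0; apply: contra_notP unc => noa.
apply: (nbhs_countable cD dD U0).
(* The index holds the multiplier, the coefficient bound and a position in the list. A position past
   the end gives the fibre over [0], countable by the same argument. *)
pose B := \bigcup_(i in [set i : int * nat * nat | i.1.1 != 0])
  [set a : A | a *~ i.1.1 = nth 0 (sums i.1.2 l) i.2].
have UB : U `<=` B.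
  move=> a Ua; apply: contrapT => Ba; apply: noa; exists a => // n M nM.
  apply: contrapT => /eqP n0; apply: Ba.
  by exists (n, M, index (a *~ n) (sums M l)) => //=; rewrite nth_index.
apply: sub_countable (subset_card_le UB) _.
apply: bigcup_countable => // -[[n M] i] /= n0.
apply: (separated_countable cD dD (torsion_discrete tor (n := `|n|%N) _)).
  by rewrite absz_gt0.
move=> s t /= sE tE E; apply/eqP; rewrite -subr_eq0; apply/eqP/E.
have : (s - t) *~ n = 0 by rewrite mulrzBl sE tE subrr.
case: (n) => [m //|m]; rewrite NegzE mulrNz => /eqP; rewrite oppr_eq0 => /eqP.
by rewrite abszN.
Qed.

(** * Metric estimates and the choice of a fast sequence *)

Lemma metric_refl (T : Type) (d : T -> T -> RR) (x : T) : is_metric d -> d x x = 0.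
Proof. by case=> d0 _ _; exact/d0. Qed.

Lemma metric_ge0 (T : Type) (d : T -> T -> RR) (x y : T) :
  is_metric d -> 0 <= d x y.
Proof.
move=> dm; have [_ dC dT] := dm.
by have := dT x y x; rewrite metric_refl// (dC y x); lra.
Qed.

Lemma metric_gt0 (T : Type) (d : T -> T -> RR) (x y : T) :
  is_metric d -> x <> y -> 0 < d x y.
Proof.
move=> dm xy; rewrite lt_neqAle metric_ge0// andbT.
by apply/eqP => /esym; case: dm => d0 _ _ /d0.
Qed.

Lemma metric_nbhs (T : topologicalType) (d : T -> T -> RR) (x : T) (e : RR) :
  metric_induces d -> 0 < e -> nbhs x [set y | d x y < e].
Proof. by move=> dn e0; apply/dn; exists e. Qed.

Lemma metric_hausdorff (T : topologicalType) (d : T -> T -> RR) :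
  is_metric d -> metric_induces d -> hausdorff_space T.
Proof.
move=> dm dn x y clxy; apply: contrapT => xy.
have e0 : 0 < d x y / 2 by rewrite divr_gt0// metric_gt0.
have [z /= [xz yz]] := clxy _ _ (metric_nbhs x dn e0) (metric_nbhs y dn e0).
by have [_ dC dT] := dm; have := dT x z y; rewrite (dC z y); lra.
Qed.

Definition half_pow (k : nat) : RR := 2^-1 ^+ k.

Lemma half_pow_gt0 (k : nat) : 0 < half_pow k.
Proof. by rewrite exprn_gt0// invr_gt0. Qed.

Lemma half_powS (k : nat) : half_pow k = 2 * half_pow k.+1.
Proof. by rewrite /half_pow exprS mulrA divff// mul1r. Qed.

Lemma half_pow_small (e : RR) : 0 < e -> exists k, half_pow k < e.
Proof.
move=> e0; have ie0 : 0 < e^-1 by rewrite invr_gt0.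
exists (Num.bound e^-1); set k := Num.bound _.
rewrite /half_pow exprVn -[ltRHS]invrK ltf_pV2 ?posrE ?exprn_gt0//.
apply: lt_trans (archi_boundP (ltW ie0)) _.
by rewrite -natrX ltr_nat; exact: ltn_expl.
Qed.

Lemma geometric_steps (T : Type) (d : T -> T -> RR) (u : nat -> T) (k : nat)
    (r : RR) :
  is_metric d -> 0 <= r ->
  (forall i, (k <= i)%N -> d (u i) (u i.+1) <= r * half_pow i.+2) ->
  forall m, (k <= m)%N -> d (u k) (u m) <= r * half_pow k.+1.
Proof.
move=> dm r0 du m km.
(* The subtracted tail makes the induction close: the next step costs half of it. *)
suff : d (u k) (u m) <= r * half_pow k.+1 - r * half_pow m.+1.
  by have := mulr_ge0 r0 (ltW (half_pow_gt0 m.+1)); lra.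
elim: m km => [|m IH]; first by rewrite leqn0 => /eqP ->; rewrite metric_refl// subrr.
rewrite leq_eqVlt => /predU1P[->|]; first by rewrite metric_refl// subrr.
rewrite ltnS => km; have := IH km; have := du m km.
have [_ _ dT] := dm; have := dT (u k) (u m) (u m.+1).
rewrite (half_powS m.+1); lra.
Qed.

(* The absolute bound makes partial sums Cauchy; the relative one keeps them away
   from [0] once they are nonzero, whence injectivity. *)
Definition fast_small (A : zmodType) (d : A -> A -> RR) (k : nat) (l : seq A)
    (a : A) : Prop :=
  forall s n, s \in sums k`! l -> (`|n| <= k`!)%N ->
    d s (s + a *~ n) < half_pow k.+2 /\
    forall t, t \in sums k`! l -> t <> 0 ->
      d s (s + a *~ n) < d 0 t * half_pow k.+2.

(** Only finitely many [s], [n], [t] occur, and [s + a *~ n] tends to [s] as [a] tends to [0], while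
    the bounds are positive and do not depend on [a]. *)
Lemma near_fast_small (A : topologicalZmodType) (d : A -> A -> RR) (k : nat)
    (l : seq A) :
  is_metric d -> metric_induces d -> \forall a \near (0 : A), fast_small d k l a.
Proof.
move=> dm dn; set L := sums k`! l.
have near_lt s n e : 0 < e -> \forall a \near (0 : A), d s (s + a *~ n) < e.
  by move=> e0; exact: near_shift (metric_nbhs s dn e0).
have : \forall a \near (0 : A), forall s, s \in L ->
    forall n, n \in int_range k`! -> d s (s + a *~ n) < half_pow k.+2 /\
    forall t, t \in L -> t <> 0 -> d s (s + a *~ n) < d 0 t * half_pow k.+2.
  apply: near_seq => s _; apply: near_seq => n _; apply: filterI.
    by apply: near_lt; exact: half_pow_gt0.
  apply: near_seq => t _; have [->|t0] := pselect (t = 0); first exact: nearW.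
  have e0 : 0 < d 0 t * half_pow k.+2.
    by rewrite mulr_gt0 ?half_pow_gt0// metric_gt0// => /esym.
  by apply: filterS (near_lt s n _ e0).
by apply: filterS => a H s n sL nk; apply: H => //; rewrite mem_int_range.
Qed.

(** The next term is a function of the list of earlier ones, whose length gives the step number; [P]
    is carried along so that the hypothesis applies again. *)
Lemma exists_fast_sequence (A : topologicalZmodType) (d : A -> A -> RR)
    (P : A -> Prop) :
  is_metric d -> metric_induces d ->
  (forall l U, (forall a, a \in l -> P a) -> nbhs 0 U ->
     exists a, [/\ U a, P a & independent_from l a]) ->
  exists a : nat -> A, forall k, [/\ P (a k),
    independent_from (prefix_rev a k) (a k) & fast_small d k (prefix_rev a k) (a k)].
Proof.
move=> dm dn exP.
have /choice[f fP] : forall l : seq A, exists a, (forall b, b \in l -> P b) ->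
    [/\ P a, independent_from l a & fast_small d (size l) l a].
  move=> l; have [lP|lP] := pselect (forall b, b \in l -> P b); last by exists 0.
  by have [a [? ? ?]] := exP l _ lP (near_fast_small (size l) l dm dn); exists a.
pose ls k := iter k (fun l => f l :: l) [::].
have lsP k : forall b, b \in ls k -> P b.
  elim: k => [//|k IH] b; rewrite /= inE => /predU1P[->|]; last exact: IH.
  by have [] := fP _ IH.
exists (f \o ls) => k.
have -> : prefix_rev (f \o ls) k = ls k.
  by elim: k => [//|k IH]; rewrite prefix_revS IH.
have szk : size (ls k) = k by elim: k => [//|k /= ->].
by have := fP _ (lsP k); rewrite szk.
Qed.

(** * Convergence and limits of series along a fast sequence *)

Definition factorial_bounded (x : nat -> int) : Prop :=
  exists K, forall k, (K <= k)%N -> (`|x k| <= k`!)%N.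

(** The finitely many early coefficients have a common bound [M], and [M <= k <= k!] as soon as [k]
    reaches [M]. *)
Lemma factorial_bounded_uniform (x : nat -> int) : factorial_bounded x ->
  exists K, forall k j, (K <= k)%N -> (j <= k)%N -> (`|x j| <= k`!)%N.
Proof.
move=> [K xK]; pose M := (\max_(i < K) `|x i|)%N.
exists (maxn K M) => k j Kk jk; have [jK|Kj] := ltnP j K.
  have jM : (`|x j| <= M)%N by exact: (leq_bigmax (Ordinal jK)).
  by have := fact_geq k; lia.
exact: leq_trans (xK j Kj) (leq_fact _).
Qed.

Section Series.
Variables (A : topologicalZmodType) (d : A -> A -> RR) (a : nat -> A).
Hypotheses (dm : is_metric d) (dn : metric_induces d) (dc : metric_complete d).
Hypothesis fast : forall k, fast_small d k (prefix_rev a k) (a k).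
Hypothesis indep : forall k, independent_from (prefix_rev a k) (a k).

Lemma fast_step (x : nat -> int) (k : nat) :
  (forall j, (j <= k)%N -> (`|x j| <= k`!)%N) ->
  d (psum a x k) (psum a x k.+1) < half_pow k.+2 /\
  forall t, t \in sums k`! (prefix_rev a k) -> t <> 0 ->
    d (psum a x k) (psum a x k.+1) < d 0 t * half_pow k.+2.
Proof.
move=> xk; rewrite psumS; apply: fast; last exact: xk.
by apply: psum_in_sums => // j jk; apply: xk; exact: ltnW.
Qed.

Lemma fast_dist (x : nat -> int) (K k m : nat) :
  (forall k j, (K <= k)%N -> (j <= k)%N -> (`|x j| <= k`!)%N) ->
  (K <= k)%N -> (k <= m)%N -> d (psum a x k) (psum a x m) <= half_pow k.+1.
Proof.
move=> xK Kk km; rewrite -[leRHS]mul1r.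
apply: (geometric_steps dm) => // i ki; rewrite mul1r.
by have [/ltW ? _] := fast_step (fun j => xK i j (leq_trans Kk ki)).
Qed.

Lemma psum_cvg (x : nat -> int) : factorial_bounded x ->
  exists l : A, psum a x @ \oo --> (l : A).
Proof.
move=> /factorial_bounded_uniform[K xK]; apply: dc => e e0.
have [k ke] := half_pow_small e0; exists (maxn K k) => m n Km Kn.
have := fast_dist xK (leq_maxl K k) Km; have := fast_dist xK (leq_maxl K k) Kn.
set s := psum a x _ => sn sm; have [_ dC dT] := dm.
have := dT (psum a x m) s (psum a x n); rewrite (dC _ s).
have : half_pow (maxn K k).+1 *+ 2 <= half_pow k.
  rewrite -mulr_natl -half_powS; apply: ler_wiXn2l; rewrite ?invr_ge0// ?leq_maxr//.
  by rewrite invf_le1// ler1n.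
lra.
Qed.

(** If a late partial sum were nonzero, the relative bound would keep all later ones within half its
    distance to [0], against convergence to [0]. So it vanishes, and independence kills its
    terms. *)
Lemma psum_cvg0 (x : nat -> int) : factorial_bounded x ->
  psum a x @ \oo --> (0 : A) -> forall j, a j *~ x j = 0.
Proof.
move=> /factorial_bounded_uniform[K xK] x0 j.
(* The successor ensures that the term of index [j] occurs in the partial sum. *)
pose k := maxn K j.+1.
apply: (psum_eq0 (k := k) indep); last by rewrite leq_maxr.
apply: contrapT => s0; have r0 := metric_gt0 dm (not_eq_sym s0).
have far m : (k <= m)%N ->
    d (psum a x k) (psum a x m) <= d 0 (psum a x k) * half_pow k.+1.
  apply: (geometric_steps dm (ltW r0)) => i ki.
  have [Ki ji] : (K <= i)%N /\ (j < i)%N by move: ki; rewrite geq_max => /andP[].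
  have [_ /(_ (psum a x k))] := fast_step (fun j => xK i j Ki).
  move=> step; apply/ltW/step => //; apply: psum_in_sums => // j' jk.
  by apply: xK => //; lia.
have e0 : 0 < d 0 (psum a x k) / 2 by rewrite divr_gt0.
have [m _ /(_ (maxn m k) (leq_maxl _ _)) /=] := x0 _ (metric_nbhs 0 dn e0).
have := far (maxn m k) (leq_maxr _ _).
have : half_pow k.+1 <= 2^-1.
  by rewrite -[leRHS]expr1; apply: ler_wiXn2l; rewrite ?invr_ge0// invf_le1// ler1n.
have [_ dC dT] := dm; set y := psum a x (maxn m k).
have := dT 0 y (psum a x k); rewrite (dC y).
set r := d 0 (psum a x k) in r0 *; set h := half_pow _; nra.
Qed.

(** The partial sum at [K] is [0], so later ones stay within [half_pow K.+1] of it. The factorial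
    bound from index [0] on makes [K] the same for all [x]. *)
Lemma psum_limit_small (U : set A) : nbhs 0 U -> exists K, forall x (l : A),
  (forall k, (k < K)%N -> x k = 0) -> (forall k, (`|x k| <= k`!)%N) ->
  psum a x @ \oo --> (l : A) -> U l.
Proof.
move=> /dn[e e0 eU]; have [K Ke] := half_pow_small e0.
exists K => x l xK xb xl; apply: eU => /=.
have := @fast_dist x 0 K _ _ (leq0n K); rewrite psum0// => far.
have [m _ /(_ (maxn m K) (leq_maxl _ _)) /=] :=
  xl _ (metric_nbhs l dn (half_pow_gt0 K.+1)).
have := far (maxn m K) _ (leq_maxr _ _); set y := psum a x _ => far'.
have {far'} := far' (fun k j _ jk => leq_trans (xb j) (leq_fact jk)).
have [_ dC dT] := dm; have := dT 0 y l; rewrite (dC l y).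
by have := half_powS K; lra.
Qed.

(** Both embeddings come from this map; its third clause is the continuity at [0] that serves the
    norm topology and the product topology alike. *)
Lemma exists_limit_map : exists f : (nat -> int) -> A,
  [/\ forall x, factorial_bounded x -> psum a x @ \oo --> f x,
      forall x, factorial_bounded x -> f x = 0 -> forall j, a j *~ x j = 0 &
      forall U, nbhs 0 U -> exists K, forall x,
        (forall k, (k < K)%N -> x k = 0) -> (forall k, (`|x k| <= k`!)%N) ->
        U (f x)].
Proof.
have /choice[f fP] : forall x, exists l : A,
    factorial_bounded x -> psum a x @ \oo --> (l : A).
  move=> x; have [/psum_cvg[l xl]|xb] := pselect (factorial_bounded x).
    by exists l.
  by exists 0.
exists f; split=> // [x xb fx0|U /psum_limit_small[K KU]].
  by apply: psum_cvg0 => //; rewrite -fx0; exact: fP.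
exists K => x xK xb; apply: (KU _ _ xK xb); apply: fP.
by exists 0%N => k _; exact: xb.
Qed.
End Series.

(** Additivity is required of the terms, not of the coefficients, so that coefficients may be
    reduced modulo [p] when the [a j] are [p]-torsion. *)
Lemma limit_add (A : topologicalZmodType) (a : nat -> A) (x y z : nat -> int)
    (lx ly lz : A) :
  hausdorff_space A ->
  (forall j, a j *~ z j = a j *~ x j + a j *~ y j) ->
  psum a x @ \oo --> lx -> psum a y @ \oo --> ly -> psum a z @ \oo --> lz ->
  lz = lx + ly.
Proof.
move=> hA zE xl yl zl; apply: (cvg_unique hA zl).
have -> : psum a z = fun k => psum a x k + psum a y k.
  by apply/funext => k; rewrite -big_split; exact: eq_bigr.
exact: cvg_add.
Qed.

(** * The sequence space l^1(Z) *)

Lemma l1_terms_ge0 (x : nat -> int) (k : nat) : 0 <= l1_terms x k.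
Proof. by rewrite divr_ge0// ler0z. Qed.

Lemma in_l1ZB (x y : nat -> int) :
  in_l1Z x -> in_l1Z y -> in_l1Z (fun k => x k - y k).
Proof.
move=> xl yl; apply: (@series_le_cvg _ _ (l1_terms x \+ l1_terms y)).
- exact: l1_terms_ge0.
- by move=> k; rewrite addr_ge0// l1_terms_ge0.
- move=> k; rewrite /= /l1_terms -mulrDl ler_pM2r ?invr_gt0 ?ltr0n ?fact_gt0//.
  by rewrite -intrD ler_int; exact: ler_normB.
- exact: is_cvg_seriesD.
Qed.

Lemma in_l1ZN (x : nat -> int) : in_l1Z x -> in_l1Z (fun k => - x k).
Proof.
suff E : l1_terms (fun k => - x k) = l1_terms x by rewrite /in_l1Z E.
by apply/funext => k; rewrite /l1_terms normrN.
Qed.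

Lemma in_l1ZD (x y : nat -> int) :
  in_l1Z x -> in_l1Z y -> in_l1Z (fun k => x k + y k).
Proof.
move=> xl /in_l1ZN yl; have := in_l1ZB xl yl.
by under eq_fun do rewrite opprK.
Qed.

Lemma l1_terms_lt (x : nat -> int) (k m : nat) :
  l1_terms x k < (m`!)%:R^-1 -> (`|x k| * m`! < k`!)%N.
Proof.
rewrite /l1_terms ltr_pdivrMr ?ltr0n ?fact_gt0// mulrC.
rewrite ltr_pdivlMr ?ltr0n ?fact_gt0//.
by rewrite -abszE -pmulrn -natrM ltr_nat.
Qed.

Lemma cvg_series_lt1 (R : realType) (u : R ^nat) :
  cvgn (series u) -> exists K, forall k, (K <= k)%N -> u k < 1.
Proof.
move=> /cvg_series_cvg_0 u0.
by have [K _ KP] := cvgr_lt _ u0 _ ltr01; exists K.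
Qed.

Lemma in_l1Z_factorial_bounded (x : nat -> int) : in_l1Z x -> factorial_bounded x.
Proof.
move=> /cvg_series_lt1[K KP]; exists K => k /KP; rewrite -[X in _ < X]invr1.
by move=> /(@l1_terms_lt x k 0); rewrite muln1 => /ltnW.
Qed.

Lemma l1_terms_le_norm (x : nat -> int) (k : nat) :
  in_l1Z x -> l1_terms x k <= l1Z_norm x.
Proof.
move=> xl; have sN : nondecreasing_seq (series (l1_terms x)).
  by apply/nondecreasing_series => // i _ _; exact: l1_terms_ge0.
apply: le_trans (nondecreasing_cvgn_le sN xl k.+1).
rewrite /series /= big_nat_recr//= lerDr sumr_ge0// => i _.
exact: l1_terms_ge0.
Qed.

(** Each term is at most the norm, so [|x k| * K! < k!]; for [k < K] the right side is at most [K!],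
    which forces [x k = 0]. *)
Lemma l1Z_norm_small (x : nat -> int) (K : nat) :
  in_l1Z x -> l1Z_norm x < (K`!)%:R^-1 ->
  (forall k, (k < K)%N -> x k = 0) /\ (forall k, (`|x k| <= k`!)%N).
Proof.
move=> xl xK.
have xkK k : (`|x k| * K`! < k`!)%N.
  by apply: l1_terms_lt; exact: le_lt_trans (l1_terms_le_norm k xl) xK.
have K0 := fact_gt0 K; split=> k; last by have := xkK k; nia.
by move=> kK; have := xkK k; have := leq_fact (ltnW kK); nia.
Qed.

(** * The two embeddings and the dichotomy *)

Lemma l1Z_embedsP (A : topologicalZmodType) (d : A -> A -> RR) :
  is_metric d -> metric_induces d -> metric_complete d ->
  (forall (l : seq A) U, nbhs 0 U ->
     exists2 a, U a & forall (n : int) M, a *~ n \in sums M l -> n = 0) ->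
  l1Z_embeds A.
Proof.
move=> dm dn dc exa.
pose P (a : A) := forall n, a *~ n = 0 -> n = 0.
have [l U _ U0|a aP] := @exists_fast_sequence A d P dm dn.
  have [a Ua an] := exa l U U0; exists a; split=> // [n a0|n M /an ->].
    (* Since [0] is always a combination, the hypothesis on [a] also gives infinite order. *)
    by apply: (an n 0%N); rewrite a0 sums0.
  by rewrite mulr0z.
have fast k : fast_small d k (prefix_rev a k) (a k) by have [] := aP k.
have indep k : independent_from (prefix_rev a k) (a k) by have [] := aP k.
have [f [fl f0 fs]] := exists_limit_map dm dn dc fast indep.
(* Differences are used because injectivity and continuity at any point both reduce to the behaviour
   of [f] at [x - y]. *)
have fB x y : in_l1Z x -> in_l1Z y -> f x = f (fun k => x k - y k) + f y.
  move=> xl yl; have xyl := in_l1ZB xl yl.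
  apply: (limit_add (metric_hausdorff dm dn) (a := a) _
    (fl _ (in_l1Z_factorial_bounded xyl)) (fl _ (in_l1Z_factorial_bounded yl))
    (fl _ (in_l1Z_factorial_bounded xl))).
  by move=> j; rewrite -mulrzDr subrK.
exists f; split=> [x y xl yl|x y xl yl fxy|x xl U].
- rewrite (fB _ y (in_l1ZD xl yl) yl); congr (f _ + _).
  by apply/funext => k; rewrite addrK.
- apply/funext => k; apply/eqP; rewrite -subr_eq0; apply/eqP.
  have [Pk _ _] := aP k; apply/Pk/(f0 (fun k => x k - y k)).
    exact/in_l1Z_factorial_bounded/in_l1ZB.
  by apply: (addIr (f y)); rewrite -fB// add0r.
- move=> /near_sub/fs[K KP]; exists (K`!)%:R^-1.
    by rewrite invr_gt0 ltr0n fact_gt0.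
  move=> y yl /(l1Z_norm_small (in_l1ZB xl yl))[xK xb].
  by have := KP _ xK xb; rewrite /= (fB x y)// addrC addKr.
Qed.

Lemma ZpN_embedsP (A : topologicalZmodType) (d : A -> A -> RR) (p : nat) :
  is_metric d -> metric_induces d -> metric_complete d -> prime p ->
  ~ (\forall a \near (0 : A), a *+ p = 0 -> a = 0) ->
  ZpN_embeds p A.
Proof.
move=> dm dn dc pp ntor; have p0 := prime_gt0 pp.
pose P (a : A) := a *+ p = 0 /\ a <> 0.
have [l U lP U0|a aP] := @exists_fast_sequence A d P dm dn.
  (* A small enough [a] avoids the nonzero elements of the finite group generated by [l]. *)
  have near_l : \forall a \near (0 : A), forall s, s \in sums p l -> s <> 0 -> a <> s.
    apply: near_seq => s _; have [->|s0] := pselect (s = 0); first exact: nearW.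
    have := metric_nbhs 0 dn (metric_gt0 dm (not_eq_sym s0)).
    by apply: filterS => a /= ds _ E; move: ds; rewrite E ltxx.
  apply: contra_notP ntor => noa; apply: filterS2 U0 near_l => a Ua al ap.
  apply: contrapT => a0; apply: noa; exists a; split=> // n M nM.
  have [pn|pn] := boolP (p%:Z %| n)%Z; first exact: torsion_mulrz_dvd ap pn.
  (* If [p] does not divide [n], then [a] is a multiple of [a *~ n] and so lies in that finite
     group, which was excluded. *)
  have [u uE] := torsion_mulrz_inv pp ap pn.
  case: (al a) => //; rewrite -{1}uE.
  by apply: sums_torsion p0 _ (sumsMz u nM) => b /lP[].
have fast k : fast_small d k (prefix_rev a k) (a k) by have [] := aP k.
have indep k : independent_from (prefix_rev a k) (a k) by have [] := aP k.
have [f [fl f0 fs]] := exists_limit_map dm dn dc fast indep.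
(* Representatives in [0, ..., p-1]; this lift is additive only modulo [p]. *)
pose lift (x : nat -> 'Z_p) (k : nat) : int := (x k : nat)%:Z.
have lift_lt (x : nat -> 'Z_p) k : (x k < p)%N.
  by apply: leq_trans (ltn_ord (x k)) _; rewrite Zp_cast ?prime_gt1.
have lift_bounded x : factorial_bounded (lift x).
  exists p => k pk; apply: leq_trans (fact_geq k).
  exact: leq_trans (ltnW (lift_lt x k)) pk.
have fD x y : f (lift (fun k => x k + y k)) = f (lift x) + f (lift y).
  apply: (limit_add (metric_hausdorff dm dn) (a := a) _ (fl _ (lift_bounded x))
    (fl _ (lift_bounded y)) (fl _ (lift_bounded _))) => j.
  have [[ap _] _ _] := aP j.
  have xyE : (x j + y j : 'Z_p) = ((x j + y j) %% p)%N :> nat.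
    by congr modn; rewrite Zp_cast ?prime_gt1.
  rewrite -mulrzDr /lift xyE -PoszD -!pmulrn.
  by rewrite [in RHS](divn_eq (x j + y j) p) mulrnDr mulnC mulrnA ap mul0rn add0r.
have fB x y : f (lift x) = f (lift (fun k => x k - y k)) + f (lift y).
  by rewrite -fD; congr (f (lift _)); apply/funext => k; rewrite subrK.
exists (f \o lift); split=> [x y|x y /= fxy|x U].
- exact: fD.
- pose z k : 'Z_p := x k - y k.
  have z0 : f (lift z) = 0 by apply: (addIr (f (lift y))); rewrite -fB add0r.
  apply/funext => k; apply/eqP; rewrite -subr_eq0 -/(z k).
  have [[ap a0] _ _] := aP k; apply: contra_notT a0 => zk_neq0.
  (* A nonzero representative lies strictly between [0] and [p], so it is prime to [p] and acts
     invertibly on [a k]. *)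
  have [u <-] : exists u, a k *~ lift z k *~ u = a k.
    apply: torsion_mulrz_inv pp ap _; rewrite dvdzE [absz _]/=.
    by rewrite gtnNdvd ?lift_lt// lt0n; exact: zk_neq0.
  by rewrite f0// mul0rz.
(* Agreement up to [p] as well gives the factorial bound everywhere: the differences vanish below
   [p], and beyond it they are less than [p <= k!]. *)
- move=> /near_sub/fs[K KP]; exists (maxn K p) => y yx.
  have -> : (f \o lift) y = f (lift x) - f (lift (fun k => x k - y k)).
    by rewrite (fB x y) addrC addKr.
  apply: KP => k.
    by move=> kK; rewrite /lift yx ?subrr//; lia.
  have [kp|pk] := ltnP k (maxn K p); first by rewrite /lift yx// subrr.
  have := lift_lt (fun k => x k - y k) k; have := fact_geq k.
  by rewrite /lift; lia.
Qed.

Theorem theorem4p2 (A : topologicalZmodType) :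
  polish_space A -> ~ countable [set: A] ->
  l1Z_embeds A \/ exists p : nat, prime p /\ ZpN_embeds p A.
Proof.
move=> [[D [cD dD]] [d [dm dn dc]]] unc.
have [tor|] := pselect
    (forall p, prime p -> \forall a \near (0 : A), a *+ p = 0 -> a = 0).
  by left; apply: (l1Z_embedsP dm dn dc) => l U; exact: exists_independent cD dD unc tor.
move=> /existsNP[p /not_implyP[pp ntor]]; right; exists p; split=> //.
exact: (ZpN_embedsP dm dn dc).
Qed.
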